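(* Let $\mathcal U\subset\mathbb R^n$ be an open connected set, let $F:\mathcal U\to\mathcal U$ be a diffeomorphism and let $X$ be a $\mathcal C^1$ vector field on $\mathcal U$ such that $X(F(q))=(DF(q))\,X(q)$ for all $q\in\mathcal U$. Let $p\in\mathcal U$ and assume that the orbit $\gamma_p$ of the differential equation $\dot x=X(x)$ is invariant by $F$. Then: (a) If $\gamma_p$ is a critical point of the differential equation, then $p$ is a fixed point of $F$. (b) If $\gamma_p$ is a periodic orbit of the differential equation, then $F$ restricted to $\gamma_p$ is conjugated to a rotation of the circle. Moreover its rotation number is $\tau/T$, where $T$ is the period of $\gamma_p$ and $\tau$ is defined by the equation $\varphi(\tau,p)=F(p)$. (c) If $\gamma_p$ is diffeomorphic to the real line, then $F$ restricted to $\gamma_p$ is conjugated to a translation of the line.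
   Context: For a $\mathcal C^1$ vector field $X$ on $\mathcal U$, $\varphi(t,p)$ denotes the solution of $\dot x=X(x)$ with $\varphi(0,p)=p$, defined on its maximal interval $I_p\subset\mathbb R$, and $\gamma_p=\{\varphi(t,p): t\in I_p\}$ is the orbit through $p$. A critical point is a zero of $X$ (then $\gamma_p=\{p\}$). A periodic orbit is a nonconstant periodic solution curve, and its period is its minimal period. A translation of the line is a map $t\mapsto t+c$ with $c\in\mathbb R$ (possibly $c=0$). Rotation numbers are considered modulo $1$: the rotation of the circle with rotation number $\rho$ is $e^{it}\mapsto e^{i(t+2\pi\rho)}$. *)

(* Defs.v *)
From HB Require Import structures.
From mathcomp Require Import all_boot all_order all_algebra.
From mathcomp Require Import all_classical all_reals all_analysis.
Set Implicit Arguments.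
Unset Strict Implicit.
Unset Printing Implicit Defensive.
Import Order.TTheory GRing.Theory Num.Theory.
Import numFieldNormedType.Exports.
Local Open Scope classical_set_scope.
Local Open Scope ring_scope.

(* R^n is ['rV[R]_n] with R : realType, as in MathComp-Analysis. *)

Definition inverse_on (S T : Type) (A : set S) (B : set T)
    (f : S -> T) (g : T -> S) : Prop :=
  [/\ set_fun A B f, set_fun B A g,
      (forall x, A x -> g (f x) = x) & (forall y, B y -> f (g y) = y)].

(* The spaces are meant to be finite-dimensional: continuity of the
   differential is then the same as its continuity in every direction v. *)
Definition C1_open (R : realType) (V W : normedModType R)
    (O : set V) (f : V -> W) : Prop :=
  [/\ open O, (forall x, O x -> differentiable f x) &
      forall v x, O x -> {for x, continuous (fun y => 'd f y v)}].

(* C^1 maps on an arbitrary subset are the restrictions, locally, of C^1 maps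
   defined on open sets; if A is open this is the usual notion. *)
Definition C1_on (R : realType) (V W : normedModType R)
    (A : set V) (f : V -> W) : Prop :=
  forall x, A x -> exists O : set V, exists g : V -> W,
    [/\ O x, C1_open O g & forall y, A y -> O y -> f y = g y].

Definition diffeomorphism (R : realType) (V W : normedModType R)
    (A : set V) (B : set W) (f : V -> W) : Prop :=
  exists g : W -> V, [/\ inverse_on A B f g, C1_on A f & C1_on B g].

Definition diffeomorphic (R : realType) (V W : normedModType R)
    (A : set V) (B : set W) : Prop :=
  exists f : V -> W, diffeomorphism A B f.

(* Topological conjugacy of f restricted to A and g restricted to B, where
   A and B carry the subspace topology. *)
Definition conjugated (S T : topologicalType)
    (A : set S) (f : S -> S) (B : set T) (g : T -> T) : Prop :=
  exists h : S -> T, exists k : T -> S,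
    [/\ inverse_on A B h k, {within A, continuous h}, {within B, continuous k}
      & forall x, A x -> h (f x) = g (h x)].

Section ODE.
Variables (R : realType) (n : nat).
Local Notation V := 'rV[R]_n.

Definition is_solution (U : set V) (X : V -> V) (I : set R) (phi : R -> V)
    : Prop :=
  [/\ open I, is_interval I, (forall t, I t -> U (phi t)) &
      forall t, I t -> is_derive t 1 phi (X (phi t))].

(* The values of phi outside I are irrelevant. *)
Definition is_maximal_solution (U : set V) (X : V -> V) (p : V)
    (I : set R) (phi : R -> V) : Prop :=
  [/\ I 0, phi 0 = p, is_solution U X I phi &
      forall (J : set R) (psi : R -> V), is_solution U X J psi ->
        I `<=` J -> (forall t, I t -> psi t = phi t) -> J = I].

Definition orbit_of (I : set R) (phi : R -> V) : set V := phi @` I.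

Definition is_critical_point (X : V -> V) (p : V) : Prop := X p = 0.

Definition is_period (phi : R -> V) (T : R) : Prop :=
  0 < T /\ forall t, phi (t + T) = phi t.

Definition is_periodic_orbit (I : set R) (phi : R -> V) : Prop :=
  [/\ I = setT, (exists s t, phi s <> phi t) & exists T, is_period phi T].

Definition is_minimal_period (phi : R -> V) (T : R) : Prop :=
  is_period phi T /\ forall S, is_period phi S -> T <= S.

(* An orbit that is neither a point nor closed is diffeomorphic to the line for
   its structure of immersed submanifold, but possibly not as a subset of R^n
   (for instance if it is dense in a torus).  A diffeomorphism from the line
   onto a curve with such a structure is a bijective C^1 immersion. *)
Definition immersed_line (A : set V) (g : R -> V) : Prop :=
  [/\ set_bij setT A g, C1_open setT g & forall s, 'D_1 g s <> 0].

End ODE.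

Definition translation (R : realType) (c : R) : R -> R := fun t => t + c.

Definition circle (R : realType) : set (R * R) :=
  [set z | z.1 ^+ 2 + z.2 ^+ 2 = 1].

(* Multiplication of z.1 + i z.2 by e^{2 i pi rho}. *)
Definition rotation (R : realType) (rho : R) (z : R * R) : R * R :=
  let a := 2 * pi * rho in
  (cos a * z.1 - sin a * z.2, sin a * z.1 + cos a * z.2).

(* Main.v *)
Require Import Defs.
From HB Require Import structures.
From mathcomp Require Import all_boot all_order all_algebra.
From mathcomp Require Import all_classical all_reals all_analysis.
From mathcomp Require Import ring lra.
Set Implicit Arguments.
Unset Strict Implicit.
Unset Printing Implicit Defensive.
Import Order.TTheory GRing.Theory Num.Theory.
Import numFieldNormedType.Exports.
Local Open Scope classical_set_scope.
Local Open Scope ring_scope.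

(** The symmetry condition says that [F] sends solutions of [x' = X(x)] to
    solutions, and by the chain rule the inverse of [F] does so too.  Since
    [F p] lies on the orbit, [F p = phi tau] for some [tau], so
    [t |-> F (phi t)] and [t |-> phi (t + tau)] are two solutions with the same
    initial value.  Uniqueness of solutions makes them equal: in the time
    parametrization of the orbit, [F] is the shift by [tau]
    ([symmetry_shifts_time]).  The three cases are three readings of this fact.

    (a) At a critical point the solution is constant, so [phi tau = p].

    (b) Uniqueness makes a periodic solution injective modulo its minimal
    period [T] ([minimal_period_injective]), exactly as [circle_exp T] is.  Two
    continuous maps of the line that are injective modulo the same period have
    canonically homeomorphic images, by compactness
    ([injective_period_homeomorphism]).  This homeomorphism carries the shift by
    [tau] to the rotation of number [tau / T].

    (c) If [phi] took the same value twice, the orbit would be a point or a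
    circle, but neither is a continuous bijective image of the line
    ([no_continuous_bijection_line_circle]); hence [phi] is injective
    ([line_orbit_injective]).  When [tau = 0], [F] is the identity on the orbit
    and any parametrization by the line gives the translation by [0].  When
    [tau <> 0], the shift by [tau] and its inverse both preserve the interval
    of definition of [phi], which is therefore the whole line, and [phi] itself
    conjugates the translation by [tau] to [F].  The inverse of [F] is essential
    here: invariance of the orbit only gives one inclusion, which would allow
    a half-line.

    The uniqueness theorem is proved in the form that this argument uses: a
    solution that meets a maximal solution is a restriction of it
    ([maximal_solution_absorbs]). *)

(** * The mean value inequality and Lipschitz bounds *)
Lemma is_derive_comp_diff (R : realType) (V W : normedModType R) (f : R -> V)
    (g : V -> W) (t : R) w :
  is_derive t 1 f w -> differentiable g (f t) ->
  is_derive t 1 (g \o f) ('d g (f t) w).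
Proof.
move=> [/derivable1_diffP fD <-] gD.
have gfD : differentiable (g \o f) t by exact: differentiable_comp.
apply: DeriveDef; first exact/derivable1_diffP.
by rewrite !deriveE// diff_comp.
Qed.

Lemma is_derive_coord (R : realType) (n : nat) (f : R -> 'rV[R]_n) (t : R) df i :
  is_derive t 1 f df -> is_derive t 1 (fun s => f s 0 i : R) (df 0 i).
Proof.
move=> [fD <-]; apply: DeriveDef; first by move/derivable_mxP: fD => /(_ 0 i).
by rewrite derive_mx// mxE.
Qed.

(** The norm on row vectors is the maximum of the coordinates, so the scalar
    mean value theorem in each coordinate gives the optimal constant. *)
Lemma mean_value_ineq (R : realType) (n : nat) (f df : R -> 'rV[R]_n)
    (a b C : R) :
  a <= b -> (forall t, a <= t <= b -> is_derive t 1 f (df t)) ->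
  (forall t, a <= t <= b -> `|df t| <= C) -> `|f b - f a| <= C * (b - a).
Proof.
move=> ab fD dfC.
have C0 : 0 <= C by apply: le_trans (dfC a _); rewrite ?lexx.
rewrite [leLHS]/Num.Def.normr/= mx_normrE.
apply: bigmax_le => [|[j i] _ /=]; first by rewrite mulr_ge0 ?subr_ge0.
rewrite (ord1 j) !mxE.
have fiD t : a <= t <= b -> is_derive t 1 (fun s => f s 0 i : R) (df t 0 i).
  by move=> tab; exact/is_derive_coord/fD.
have [c cab ->] : exists2 c, c \in `[a, b] & f b 0 i - f a 0 i = df c 0 i * (b - a).
  apply: (@MVT_segment _ (fun s => f s 0 i) (fun s => df s 0 i)) => //.
    by move=> t; rewrite in_itv/= => /andP[/ltW at_ /ltW tb]; apply: fiD; rewrite at_ tb.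
  apply: derivable_within_continuous => t; rewrite in_itv/= => tab.
  by have [] := fiD t tab.
rewrite normrM [`|b - a|]ger0_norm ?subr_ge0// ler_wpM2r ?subr_ge0//.
rewrite in_itv/= in cab; apply: le_trans (dfC c cab).
rewrite [leRHS]/Num.Def.normr/= mx_normrE.
exact: (le_bigmax _ (fun k : 'I_1 * 'I_n => `|df c k.1 k.2|) (0, i)).
Qed.

(** Continuity of the differential in the directions of the canonical basis
    bounds its operator norm near [q]; the mean value inequality along segments
    of a ball, which is convex, turns this bound into a Lipschitz constant. *)
Lemma C1_open_lipschitz (R : realType) (n : nat) (O : set 'rV[R]_n)
    (g : 'rV[R]_n -> 'rV[R]_n) q :
  C1_open O g -> O q -> exists K, exists2 d, 0 < d &
    forall x y, `|q - x| < d -> `|q - y| < d ->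
    `|g x - g y| <= K * `|x - y|.
Proof.
move=> [oO gD gC] Oq.
have dist1 (v w : 'rV[R]_n) : `|v - w| <= 1 -> `|w| <= `|v| + 1.
  by move=> vw; rewrite -lerBlDl (le_trans (lerB_dist _ _))// distrC.
pose e i : 'rV[R]_n := delta_mx 0 i.
pose K := \sum_(i < n) (`|'d g q (e i)| + 1).
have /nbhs_ballP[d /= d0 dP] : \forall y \near q,
    O y /\ forall i, `|'d g y (e i)| <= `|'d g q (e i)| + 1.
  near=> y; split; first by near: y; exact: open_nbhs_nbhs.
  near: y; apply: filter_forall => i.
  have /cvgrPdist_le/(_ _ ltr01) := gC (e i) q Oq.
  by apply: filterS => y /dist1.
exists K, d => // x y xd yd.
have dgK z v : `|q - z| < d -> `|'d g z v| <= K * `|v|.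
  move=> zd; have [_ zP] : O z /\ forall i, `|'d g z (e i)| <= `|'d g q (e i)| + 1.
    by apply: dP; rewrite -ball_normE.
  rewrite [in leLHS](row_sum_delta v) linear_sum.
  apply: le_trans (ler_norm_sum _ _ _) _.
  rewrite [leRHS]mulr_suml; apply: ler_sum => i _.
  rewrite [X in `|X|]linearZ normrZ [leLHS]mulrC.
  apply: ler_pM => //.
  rewrite [leRHS]/Num.Def.normr/= mx_normrE.
  exact: (le_bigmax _ (fun k : 'I_1 * 'I_n => `|v k.1 k.2|) (0, i)).
pose z (s : R) := y + s *: (x - y).
have zd s : 0 <= s <= 1 -> `|q - z s| < d.
  move=> /andP[s0 s1].
  have -> : q - z s = s *: (q - x) + (1 - s) *: (q - y).
    by rewrite /z; apply/rowP => i; rewrite !mxE; ring.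
  have [->|sn0] := eqVneq s 0; first by rewrite scale0r add0r subr0 scale1r.
  rewrite (le_lt_trans (ler_normD _ _))// !normrZ (ger0_norm s0).
  rewrite ger0_norm ?subr_ge0// [ltRHS](_ : d = s * d + (1 - s) * d); last by ring.
  rewrite ltr_leD// ?ltr_pM2l ?lt0r ?sn0//.
  by rewrite ler_wpM2l ?subr_ge0// ltW.
have z0 : z 0 = y by rewrite /z scale0r addr0.
have z1 : z 1 = x by rewrite /z scale1r addrC subrK.
rewrite -[in leLHS]z0 -[in leLHS]z1 -[leRHS]mulr1 -[X in _ * X]subr0.
apply: (@mean_value_ineq R n (g \o z) (fun s => 'd g (z s) (x - y))) => //.
- move=> t t01.
  apply: is_derive_comp_diff; last first.
    apply: gD; have [] // : O (z t) /\
        forall i, `|'d g (z t) (e i)| <= `|'d g q (e i)| + 1.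
      by apply: dP; rewrite -ball_normE; exact: zd.
  apply: is_derive_eq (_ : 0 + (1 *: (x - y)) = _); last by rewrite add0r scale1r.
  have -> : z = cst y + (fun s : R => s *: (x - y)) by [].
  apply: is_deriveD.
  apply: DeriveDef; first by apply/derivable1_diffP/ex_diff.
  by rewrite deriveE ?diff_val//; exact: ex_diff.
- by move=> t t01; apply: dgK; exact: zd.
Unshelve. all: by end_near. Qed.

(** * Uniqueness of solutions *)

(** On a segment of radius [e] around [t0] with [K * e <= 1/2], where [K] is a
    Lipschitz constant of [X], the maximal distance [M] between the two
    solutions satisfies [M <= K * M * e <= M / 2], hence vanishes. *)
Lemma solution_eq_near (R : realType) (n : nat) (U : set 'rV[R]_n)
    (X : 'rV[R]_n -> 'rV[R]_n) (I J : set R) (phi psi : R -> 'rV[R]_n) t0 :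
  C1_on U X -> is_solution U X I phi -> is_solution U X J psi ->
  I t0 -> J t0 -> phi t0 = psi t0 -> \forall t \near t0, phi t = psi t.
Proof.
move=> XC [oI _ phiU phiD] [oJ _ psiU psiD] It0 Jt0 eq0.
have [W [g [Oq gC Xg]]] := XC _ (phiU _ It0).
have oO : open W by case: gC.
have [K0 [d d0 lip0]] := C1_open_lipschitz gC Oq.
pose K := `|K0| + 1.
have K_gt0 : 0 < K by rewrite ltr_wpDl.
have lip x y : `|phi t0 - x| < d -> `|phi t0 - y| < d -> `|g x - g y| <= K * `|x - y|.
  move=> xd yd; rewrite (le_trans (lip0 _ _ xd yd))// ler_wpM2r//.
  by rewrite (le_trans (ler_norm _))// lerDl.
have phiC t : I t -> {for t, continuous phi}.
  by move=> It; apply/differentiable_continuous/derivable1_diffP; case: (phiD t It).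
have psiC t : J t -> {for t, continuous psi}.
  by move=> Jt; apply/differentiable_continuous/derivable1_diffP; case: (psiD t Jt).
have nq : \forall y \near phi t0, W y /\ `|phi t0 - y| < d.
  near=> y; split; first by near: y; exact: open_nbhs_nbhs.
  by near: y; apply: cvgr_dist_lt.
have /nbhs_ballP[r /= r0 rP] : \forall t \near t0,
    [/\ I t, J t, W (phi t) /\ `|phi t0 - phi t| < d
      & W (psi t) /\ `|phi t0 - psi t| < d].
  near=> t; split; near: t.
  - exact: open_nbhs_nbhs.
  - exact: open_nbhs_nbhs.
  - exact: (phiC _ It0 _ nq).
  - by apply: (psiC _ Jt0 [set y | W y /\ `|phi t0 - y| < d]); rewrite -eq0.
(* Small enough to stay in the ball and to make [K * e <= 1/2]. *)
pose e := Num.min (r / 2) (K^-1 / 2).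
have e0 : 0 < e by rewrite lt_min !divr_gt0// invr_gt0.
have er : e < r by rewrite gt_min gtr_pMr// invf_lt1 ?ltr1n.
have eK : K * e <= 2^-1.
  by rewrite -ler_pdivlMl// ge_min lexx orbT.
have AP t : t0 - e <= t <= t0 + e ->
    [/\ I t, J t, W (phi t) /\ `|phi t0 - phi t| < d
      & W (psi t) /\ `|phi t0 - psi t| < d].
  move=> tA; apply: rP; rewrite -ball_normE/=.
  by rewrite (le_lt_trans _ er)// ler_distlC.
have fD t : t0 - e <= t <= t0 + e ->
    is_derive t 1 (phi - psi) (X (phi t) - X (psi t)).
  by move=> /AP[It Jt _ _]; apply: is_deriveB; [exact: phiD|exact: psiD].
have XK t : t0 - e <= t <= t0 + e ->
    `|X (phi t) - X (psi t)| <= K * `|phi t - psi t|.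
  move=> /AP[It Jt [? ?] [? ?]]; rewrite !Xg//; [exact: lip|exact: psiU|exact: phiU].
have [c cA cmax] : exists2 c, c \in `[t0 - e, t0 + e]%classic &
    forall t, t \in `[t0 - e, t0 + e]%classic ->
      `|phi t - psi t| <= `|phi c - psi c|.
  apply: compact_EVT_max; last 2 first.
  - exact: segment_compact.
  - apply: continuous_in_subspaceT => t; rewrite inE/= in_itv/= => tA.
    have [It Jt _ _] := AP t tA.
    apply: (@cvg_norm _ _ _ _ _ (fun t => phi t - psi t)).
    by apply: cvgB; [exact: phiC|exact: psiC].
  - exists t0; rewrite /= in_itv/=; lra.
rewrite inE/= in_itv/= in cA.
have cmax' t : t0 - e <= t <= t0 + e -> `|phi t - psi t| <= `|phi c - psi c|.
  by move=> tA; apply: cmax; rewrite inE/= in_itv.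
set M := `|phi c - psi c| in cmax cmax'.
have M_ge0 : 0 <= M := normr_ge0 _.
have dM t : t0 - e <= t <= t0 + e -> `|X (phi t) - X (psi t)| <= K * M.
  by move=> tA; rewrite (le_trans (XK t tA))// ler_wpM2l ?(ltW K_gt0)// cmax'.
have KM0 : 0 <= K * M by rewrite mulr_ge0 ?(ltW K_gt0)// normr_ge0.
have M0 : M <= K * M * e.
  have [ct|tc] := leP c t0.
  - have := @mean_value_ineq R n (phi - psi)
      (fun t => X (phi t) - X (psi t)) c t0 (K * M) ct.
    rewrite [X in `|X - _|](_ : _ = 0) ?sub0r ?normrN => [H|]; last first.
      by rewrite /GRing.add/=/GRing.opp/= eq0 subrr.
    apply: le_trans (H _ _) _.
    + by move=> t ?; apply: fD; lra.
    + by move=> t ?; apply: dM; lra.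
    + by rewrite ler_wpM2l//; lra.
  - have := @mean_value_ineq R n (phi - psi)
      (fun t => X (phi t) - X (psi t)) t0 c (K * M) (ltW tc).
    rewrite [X in `|_ - X|](_ : _ = 0) ?subr0 => [H|]; last first.
      by rewrite /GRing.add/=/GRing.opp/= eq0 subrr.
    apply: le_trans (H _ _) _.
    + by move=> t ?; apply: fD; lra.
    + by move=> t ?; apply: dM; lra.
    + by rewrite ler_wpM2l//; lra.
have {}M0 : M = 0.
  apply/eqP; rewrite eq_le M_ge0 andbT.
  have : M * (K * e) <= M * 2^-1 by rewrite ler_wpM2l.
  by move: M0; rewrite mulrAC [K * e * M]mulrC; lra.
apply/nbhs_ballP; exists e => //= t; rewrite -ball_normE/= => te.
apply/eqP; rewrite -subr_eq0 -normr_le0 -M0; apply: cmax'.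
by move: te; rewrite ltr_distlC => /andP[/ltW -> /ltW ->].
Unshelve. all: by end_near. Qed.

(** The set of times at which two solutions agree is closed by continuity and
    open by local uniqueness, while their common domain is connected. *)
Lemma solution_unique (R : realType) (n : nat) (U : set 'rV[R]_n)
    (X : 'rV[R]_n -> 'rV[R]_n) (I J : set R) (phi psi : R -> 'rV[R]_n) t0 :
  C1_on U X -> is_solution U X I phi -> is_solution U X J psi ->
  I t0 -> J t0 -> phi t0 = psi t0 ->
  forall t, I t -> J t -> phi t = psi t.
Proof.
move=> XC phiS psiS It0 Jt0 eq0.
have [oI iI phiU phiD] := phiS; have [oJ iJ psiU psiD] := psiS.
pose A := I `&` J; pose B := [set t | A t /\ phi t = psi t].
have oA : open A by exact: openI.
have iA : is_interval A.
  move=> x y [Ix Jx] [Iy Jy] z xzy; split; first exact: (iI x y).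
  exact: (iJ x y).
suff BA : B = A by move=> t It Jt; have [] : B t by rewrite BA.
have /connected_intervalP := iA; apply; first by exists t0.
  exists B; last by apply/seteqP; split => t; [case=> ? ?|case].
  rewrite openE => t [[It Jt] eqt]; rewrite /interior.
  near=> s; split; near: s; first exact: open_nbhs_nbhs.
  exact: solution_eq_near XC phiS psiS It Jt eqt.
exists (closure B); first exact: closed_closure.
apply/seteqP; split => t; first by move=> Bt; split; [case: Bt|exact: subset_closure].
move=> [[It Jt] clt]; split => //.
have phiC : {for t, continuous phi}.
  by apply/differentiable_continuous/derivable1_diffP; case: (phiD t It).
have psiC : {for t, continuous psi}.
  by apply/differentiable_continuous/derivable1_diffP; case: (psiD t Jt).
apply/eqP; rewrite -subr_eq0 -normr_le0; apply/ler_addgt0Pr => e e0; rewrite add0r.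
have /cvgr_dist_le/(_ e e0) : phi s - psi s @[s --> t] --> phi t - psi t.
  exact: cvgB.
move=> /clt[s [[_ eqs]]] /=.
by rewrite eqs subrr subr0.
Unshelve. all: by end_near. Qed.

(** * Differentiability of maps that are C1 on an open set *)

(** Differentiability at a point is local; the candidate differential of [g] is
    that of [f]. *)
Lemma near_eq_differentiable (R : numFieldType) (V W : normedModType R)
    (f g : V -> W) (x : V) :
  (\near x, f x = g x) -> differentiable f x -> differentiable g x.
Proof.
move=> fg fD.
have fgx : f x = g x by exact: nbhs_singleton fg.
have gE : g \o shift x = cst (g x) + 'd f x +o_ 0 id.
  apply/eqaddoE/eqaddoP => e e0.
  have /diff_locally/eqaddoP/(_ e e0) := fD.
  have : \forall y \near 0, f (y + x) = g (y + x).
    by move: fg; rewrite (near_shift 0)/= subr0; apply: filterS.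
  by apply: filterS2 => y; rewrite /GRing.add/=/GRing.opp/= => <-; rewrite -fgx.
apply/diff_locallyP; rewrite (diff_unique _ gE); last exact: diff_continuous.
by split; first exact: diff_continuous.
Qed.

Lemma C1_on_differentiable (R : realType) (V W : normedModType R)
    (U : set V) (f : V -> W) q :
  open U -> C1_on U f -> U q -> differentiable f q.
Proof.
move=> oU fC Uq; have [A [g [Aq [oA gD _] fg]]] := fC q Uq.
apply: near_eq_differentiable (gD _ Aq).
near=> y; apply/esym/fg; near: y; exact: open_nbhs_nbhs.
Unshelve. all: by end_near. Qed.

(** Differentiating [G \o F = id] at [G q] shows that ['d G q] inverts
    ['d F (G q)], which sends [X (G q)] to [X q]. *)
Lemma inverse_symmetry (R : realType) (V : normedModType R) (U : set V)
    (F G X : V -> V) :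
  open U -> inverse_on U U F G ->
  (forall q, U q -> differentiable F q) ->
  (forall q, U q -> differentiable G q) ->
  (forall q, U q -> X (F q) = 'd F q (X q)) ->
  forall q, U q -> X (G q) = 'd G q (X q).
Proof.
move=> oU [FU GU GK FK] FD GD FX q Uq.
have UGq : U (G q) by exact: GU.
have -> : X q = 'd F (G q) (X (G q)) by rewrite -FX// FK.
have GFq : differentiable G (F (G q)) by rewrite FK//; exact: GD.
have GFD : differentiable (G \o F) (G q).
  by apply: differentiable_comp => //; exact: FD.
have GE : 'd G (F (G q)) = 'd G q :> (V -> V) by rewrite FK.
have := congr1 (@^~ (X (G q))) (diff_comp (FD _ UGq) GFq).
rewrite /= GE => <-.
rewrite -deriveE// (@near_eq_derive _ _ _ _ id) ?derive_id//.
near=> y; apply: GK; near: y; exact: open_nbhs_nbhs.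
Unshelve. all: by end_near. Qed.

(** * Maximal solutions and symmetries *)

Section Flow.
Variables (R : realType) (n : nat).
Local Notation V := 'rV[R]_n.
Implicit Types (U : set V) (X F G : V -> V) (I J : set R) (phi psi : R -> V).

Lemma is_solution_symmetry U X F I phi :
  set_fun U U F -> (forall q, U q -> differentiable F q) ->
  (forall q, U q -> X (F q) = 'd F q (X q)) ->
  is_solution U X I phi -> is_solution U X I (F \o phi).
Proof.
move=> FU FD FX [oI iI phiU phiD]; split => // t It; first exact/FU/phiU.
rewrite [X _]FX; last exact: phiU.
by apply: is_derive_comp_diff; [exact: phiD|exact/FD/phiU].
Qed.

Lemma is_solution_shift U X I phi a :
  is_solution U X I phi ->
  is_solution U X [set t | I (t + a)] (fun t => phi (t + a)).
Proof.
move=> [oI iI phiU phiD]; split.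
- have /continuousP : continuous (shift a : R -> R).
    by move=> x; apply: cvgD; [exact: cvg_id|exact: cvg_cst].
  exact.
- move=> x y Ix Iy z /andP[xz zy]; apply: (iI _ _ Ix Iy).
  by rewrite !lerD2r xz.
- by move=> t; exact: phiU.
- move=> t It; have [phitD <-] := phiD _ It.
  rewrite deriveE; last exact/derivable1_diffP.
  by apply: (is_derive_comp_diff (is_derive_shift t 1 a)); exact/derivable1_diffP.
Qed.

Lemma is_solution_cst U X q : U q -> X q = 0 -> is_solution U X setT (cst q).
Proof.
move=> Uq Xq; split => //; first exact: openT.
by move=> t _ /=; rewrite Xq; exact: is_derive_cst.
Qed.

(** By uniqueness the two solutions glue to one on the union of the domains,
    which maximality forbids to exceed [I].  All the global facts on [phi] below
    are obtained by choosing [psi] well. *)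
Lemma maximal_solution_absorbs U X p I phi J psi t0 :
  C1_on U X -> is_maximal_solution U X p I phi -> is_solution U X J psi ->
  I t0 -> J t0 -> phi t0 = psi t0 ->
  J `<=` I /\ forall t, J t -> psi t = phi t.
Proof.
move=> XC [_ _ phiS phiM] psiS It0 Jt0 eq0.
have eqIJ := solution_unique XC phiS psiS It0 Jt0 eq0.
have [oI iI phiU phiD] := phiS; have [oJ iJ psiU psiD] := psiS.
pose chi t := if `[< I t >] then phi t else psi t.
have chiI t : I t -> chi t = phi t by rewrite /chi => It; rewrite asboolT.
have chiJ t : J t -> chi t = psi t.
  by rewrite /chi => Jt; case: asboolP => // It; exact: eqIJ.
have chiS : is_solution U X (I `|` J) chi.
  split; first exact: openU.
  - apply/connected_intervalP/connectedU; first by exists t0.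
      exact/connected_intervalP.
    exact/connected_intervalP.
  - by move=> t [It|Jt]; [rewrite chiI//; exact: phiU|rewrite chiJ//; exact: psiU].
  - move=> t [It|Jt].
    + rewrite chiI//; apply: near_eq_is_derive (phiD t It).
      near=> s; rewrite chiI//; near: s; exact: open_nbhs_nbhs.
    + rewrite chiJ//; apply: near_eq_is_derive (psiD t Jt).
      near=> s; rewrite chiJ//; near: s; exact: open_nbhs_nbhs.
have IJ : I `|` J = I by apply: phiM chiS _ chiI => t; left.
have JI : J `<=` I by rewrite -IJ => t; right.
by split => // t Jt; rewrite -chiJ// chiI//; exact: JI.
Unshelve. all: by end_near. Qed.

(** The constant at a critical point is a solution on the whole line. *)
Lemma critical_orbit_constant U X p I phi t0 :
  C1_on U X -> is_maximal_solution U X p I phi -> I t0 -> X (phi t0) = 0 ->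
  forall t, I t -> phi t = phi t0.
Proof.
move=> XC phiM It0 X0 t It; have [_ _ [_ _ phiU _] _] := phiM.
have cS := is_solution_cst (phiU _ It0) X0.
have [_ H] := maximal_solution_absorbs XC phiM cS It0 Logic.I erefl.
exact/esym/H.
Qed.

Lemma is_interval_shift_invariant I T t0 : is_interval I -> T != 0 -> I t0 ->
  (forall t, I t -> I (t + T)) -> (forall t, I t -> I (t - T)) -> I = setT.
Proof.
move=> iI T0 It0 IT INT.
wlog {T0} T0 : T IT INT / 0 < T.
  move=> wl; have [TN|TP|/eqP] := ltgtP T 0; [|exact: (wl T)|by rewrite (negbTE T0)].
  by apply: (wl (- T)) => //; [move=> t; rewrite opprK; exact: IT|rewrite oppr_gt0].
have IM (k : nat) : I (t0 + T *+ k) /\ I (t0 - T *+ k).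
  elim: k => [|k [IHk IHNk]]; first by rewrite mulr0n subr0 addr0.
  by rewrite mulrSr opprD !addrA; split; [exact: IT|exact: INT].
apply/seteqP; split => // t _.
pose k := (Num.truncn (`|t - t0| / T)).+1.
have tk : `|t - t0| <= T *+ k.
  by rewrite -mulr_natr -ler_pdivrMl// mulrC ltW// truncnS_gt.
have [I1 I2] := IM k; apply: (iI _ _ I2 I1).
by move: tk; rewrite ler_norml; lra.
Qed.

(** The translates of [phi] by [b - a] and by [a - b] meet [phi], hence are
    restrictions of it; so the domain is invariant under both shifts. *)
Lemma noninjective_solution_periodic U X p I phi a b :
  C1_on U X -> is_maximal_solution U X p I phi ->
  I a -> I b -> a < b -> phi a = phi b -> I = setT /\ is_period phi (b - a).
Proof.
move=> XC phiM Ia Ib ab eqab; have [_ _ phiS _] := phiM.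
have [I1 p1] : [set t | I (t + (b - a))] `<=` I /\
    forall t, I (t + (b - a)) -> phi (t + (b - a)) = phi t.
  apply: (maximal_solution_absorbs XC phiM (is_solution_shift (b - a) phiS) Ia) => /=.
    by rewrite addrC subrK.
  by rewrite addrC subrK.
have [I2 p2] : [set t | I (t + (a - b))] `<=` I /\
    forall t, I (t + (a - b)) -> phi (t + (a - b)) = phi t.
  apply: (maximal_solution_absorbs XC phiM (is_solution_shift (a - b) phiS) Ib) => /=.
    by rewrite addrC subrK.
  by rewrite addrC subrK.
have IT : I = setT.
  have [_ iI _ _] := phiS.
  apply: (@is_interval_shift_invariant I (b - a) a) => //.
  - by rewrite subr_eq0 gt_eqF.
  - by move=> t It; apply: I2; rewrite /= -addrA [b - a + _]addrC subrKA subrr addr0.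
  - by move=> t It; apply: I1; rewrite /= subrK.
by split=> //; split=> [|t]; [rewrite subr_gt0|apply: p1; rewrite IT].
Qed.

(** The solutions [F \o phi] delayed by [tau] and [F^-1 \o phi] advanced by
    [tau] both meet [phi], at times [tau] and [0] respectively.  The first gives
    the formula and stability of [I] under [+ tau], the second its stability
    under [- tau]. *)
Lemma symmetry_shifts_time U X F p I phi tau :
  open U -> C1_on U X -> diffeomorphism U U F ->
  (forall q, U q -> X (F q) = 'd F q (X q)) ->
  is_maximal_solution U X p I phi -> I tau -> phi tau = F p ->
  forall t, I t -> [/\ I (t + tau), I (t - tau) & F (phi t) = phi (t + tau)].
Proof.
move=> oU XC [G [[FU GU GK FK] FC GC]] FX phiM Itau eqtau.
have [I0 phi0 phiS _] := phiM.
have [_ _ phiU _] := phiS.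
have FD q : U q -> differentiable F q by exact: C1_on_differentiable.
have GD q : U q -> differentiable G q by exact: C1_on_differentiable.
have GX := inverse_symmetry oU (And4 FU GU GK FK) FD GD FX.
have [I1 p1] : [set t | I (t - tau)] `<=` I /\
    forall t, I (t - tau) -> F (phi (t - tau)) = phi t.
  apply: (maximal_solution_absorbs XC phiM (is_solution_shift (- tau)
    (is_solution_symmetry FU FD FX phiS)) Itau) => /=; by rewrite subrr ?phi0.
have [I2 p2] : [set t | I (t + tau)] `<=` I /\
    forall t, I (t + tau) -> G (phi (t + tau)) = phi t.
  apply: (maximal_solution_absorbs XC phiM (is_solution_shift tau
    (is_solution_symmetry GU GD GX phiS)) I0) => /=; rewrite add0r//.
  by rewrite eqtau -phi0 GK//; exact: phiU.
move=> t It; split.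
- by apply: I1; rewrite /= addrK.
- by apply: I2; rewrite /= subrK.
- by have := p1 (t + tau); rewrite addrK; apply.
Qed.

End Flow.

(** * Periodic curves *)

(** A continuous map from a compact space to a Hausdorff one is closed, hence a
    quotient map onto its image: a map out of the image is continuous as soon
    as its composite with [f] is. *)
Lemma compact_factor_continuous (S T1 T2 : topologicalType) (K : set S)
    (f : S -> T1) (g : S -> T2) (h : T1 -> T2) :
  hausdorff_space T1 -> compact K ->
  {within K, continuous f} -> {within K, continuous g} ->
  (forall s, K s -> h (f s) = g s) -> {within f @` K, continuous h}.
Proof.
move=> T1H cK fC gC hf; apply/continuous_closedP => C cC.
have [D cD DK] : exists2 D, closed D & D `&` K = (g @^-1` C) `&` K.
  by move/continuous_closedP/(_ C cC)/closed_subspaceP : gC.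
apply/closed_subspaceP; exists (f @` (K `&` D)).
  apply: compact_closed => //; apply: continuous_compact.
    by apply: continuous_subspaceW fC => s [].
  exact: compact_closedI.
have KD s : K s -> D s <-> C (g s).
  move=> Ks; split => [Ds|Cgs].
    by have : (D `&` K) s by []; rewrite DK => -[].
  by have : ((g @^-1` C) `&` K) s by []; rewrite -DK => -[].
apply/seteqP; split=> y [].
  move=> [s [Ks Ds] <-] _; split; last by exists s.
  suff : C (h (f s)) by []; rewrite hf//; exact/KD.
move=> /[swap] -[s Ks <-] Chfs; split; last by exists s.
have {}Chfs : C (h (f s)) by []; rewrite hf// in Chfs.
by exists s => //; split => //; exact/KD.
Qed.

Section Periodic.
Variable R : realType.

(** The representative is [t - k * T] with [k] the integral part of
    [(t - s) / T]; it serves all functions of period [T] at once, which lets two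
    such functions be compared. *)
Lemma periodic_representative (T s t : R) : 0 < T ->
  exists2 r, s <= r < s + T &
    forall (S : Type) (f : R -> S), (forall t, f (t + T) = f t) -> f r = f t.
Proof.
move=> T0; have /andP[k1 k2] := floor_itv ((t - s) / T).
set k := Num.floor _ in k1 k2.
exists (t - k%:~R * T).
  move: k1 k2; rewrite intrD ler_pdivlMr// ltr_pdivrMr// mulrDl mul1r; lra.
move=> S f fT.
have fTn (n : nat) u : f (u + n%:R * T) = f u.
  elim: n => [|n IHn]; first by rewrite mul0r addr0.
  by rewrite -natr1 mulrDl mul1r addrA fT.
case: k {k1 k2} => n; first by rewrite -[LHS](fTn n) subrK.
by rewrite NegzE mulrNz mulNr opprK fTn.
Qed.

(** Such an [f] identifies exactly the points of the line that differ by a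
    multiple of [T]: it factors through an injection of the circle [R / TZ]. *)
Definition injective_period (S : Type) (f : R -> S) (T : R) :=
  [/\ 0 < T, forall t, f (t + T) = f t &
      forall s t, s <= t < s + T -> f s = f t -> s = t].

Lemma injective_period_factor (S1 S2 : Type) (f : R -> S1) (g : R -> S2) T s t :
  injective_period f T -> injective_period g T -> f s = f t -> g s = g t.
Proof.
move=> [T0 fT fI] [_ gT _] fst.
have [r sr rt] := periodic_representative s t T0.
by rewrite -(rt _ _ gT) -(fI s r)// (rt _ _ fT).
Qed.

Lemma injective_period_range (S : Type) (f : R -> S) T :
  injective_period f T -> range f = f @` `[0, T].
Proof.
move=> [T0 fT _]; apply/seteqP; split => [y [t _ <-]|y [t _ <-]]; last by exists t.
have [r /andP[r0 rT] <-//] := periodic_representative 0 t T0.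
by exists r => //=; rewrite in_itv/= r0 -[leRHS]add0r ltW.
Qed.

(** Both images are quotients of the compact [`[0, T]] by the same
    identification of its endpoints. *)
Lemma injective_period_homeomorphism (S1 S2 : topologicalType) (f : R -> S1)
    (g : R -> S2) T :
  hausdorff_space S1 -> hausdorff_space S2 -> continuous f -> continuous g ->
  injective_period f T -> injective_period g T ->
  exists h k, [/\ inverse_on (range f) (range g) h k,
    {within range f, continuous h}, {within range g, continuous k} &
    forall t, h (f t) = g t].
Proof.
move=> H1 H2 fC gC fT gT.
pose h y := g (xget 0 [set t | f t = y]).
pose k z := f (xget 0 [set t | g t = z]).
have hE t : h (f t) = g t.
  by apply: (injective_period_factor fT gT); case: xgetP => [//|/(_ t)/=].
have kE t : k (g t) = f t.
  by apply: (injective_period_factor gT fT); case: xgetP => [//|/(_ t)/=].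
exists h, k; split => //.
- split.
  + by move=> _ [t _ <-]; rewrite hE; exists t.
  + by move=> _ [t _ <-]; rewrite kE; exists t.
  + by move=> _ [t _ <-]; rewrite hE kE.
  + by move=> _ [t _ <-]; rewrite kE hE.
- rewrite (injective_period_range fT).
  apply: (@compact_factor_continuous _ _ _ _ _ g) => //.
  + exact: segment_compact.
  + exact: continuous_subspaceT.
  + exact: continuous_subspaceT.
- rewrite (injective_period_range gT).
  apply: (@compact_factor_continuous _ _ _ _ _ f) => //.
  + exact: segment_compact.
  + exact: continuous_subspaceT.
  + exact: continuous_subspaceT.
Qed.

(** The infimum of the periods satisfies the equation of a period by
    continuity; if it were zero, arbitrarily small periods and continuity at
    [0] would make [phi] constant. *)
Lemma minimal_period_exists (n : nat) (phi : R -> 'rV[R]_n) :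
  continuous phi -> (exists s t, phi s <> phi t) ->
  (exists T, is_period phi T) -> exists T, is_minimal_period phi T.
Proof.
move=> phiC [s0 [t0 neq]] [T0 T0P].
pose P : set R := [set S | is_period phi S].
have P0 : lbound P 0 by move=> S [/ltW].
have Pinf : has_inf P by split; [exists T0|exists 0].
have adh (d : R) : 0 < d -> exists2 S, P S & inf P <= S < inf P + d.
  move=> d0; have [S PS Sd] := inf_adherent d0 Pinf.
  by exists S => //; rewrite Sd andbT; apply: ge_inf => //; exists 0.
have close u e : 0 < e -> exists2 d, 0 < d &
    forall t, u <= t < u + d -> `|phi u - phi t| < e.
  move=> e0; have /cvgrPdist_lt/(_ e e0)/nbhs_ballP[d/= d0 dP] := phiC u.
  exists d => // t /andP[ut td]; apply: dP; rewrite -ball_normE/= distrC.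
  by rewrite ger0_norm; lra.
have per t : phi (t + inf P) = phi t.
  apply/eqP; rewrite -subr_eq0 -normr_le0; apply/ler_addgt0Pr => e e0; rewrite add0r.
  have [d d0 dP] := close (t + inf P) e e0.
  have [S [S0 SP] Sd] := adh d d0.
  by rewrite -(SP t) ltW// dP//; lra.
have inf_ge0 : 0 <= inf P by apply: lb_le_inf => //; exists T0.
exists (inf P); split; last by move=> S PS; apply: ge_inf => //; exists 0.
split => //; rewrite lt_neqAle inf_ge0 andbT; apply/eqP => inf0; case: neq.
suff cst t : phi t = phi 0 by rewrite !cst.
apply/eqP; rewrite eq_sym -subr_eq0 -normr_le0; apply/ler_addgt0Pr => e e0.
rewrite add0r; have [d d0 dP] := close 0 e e0.
have [S [S0 SP] Sd] := adh d d0.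
have [r rS <-//] := periodic_representative 0 t S0.
by rewrite ltW// dP//; lra.
Qed.

Definition circle_exp (T t : R) : R * R :=
  (cos (2 * pi * t / T), sin (2 * pi * t / T)).

Lemma circle_exp_continuous T : continuous (circle_exp T).
Proof.
have lin : continuous (fun t : R => 2 * pi * t / T).
  by move=> t; apply: cvgM; [apply: cvgM|]; [exact: cvg_cst|exact: cvg_id|exact: cvg_cst].
move=> t; have cC := continuous_comp (lin t) (@continuous_cos R _).
have sC := continuous_comp (lin t) (@continuous_sin R _).
exact: (cvg_pair cC sC).
Qed.

(** The half-angle [x / 2] lies in [[0, pi[], where [sin] vanishes only at [0]. *)
Lemma cos_eq1 (x : R) : 0 <= x < pi *+ 2 -> cos x = 1 -> x = 0.
Proof.
move=> /andP[x0 x2]; apply: contra_eq => xn0.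
have : 0 < sin (x / 2).
  have x_gt0 : 0 < x by rewrite lt0r xn0.
  apply: sin_gt0_pi; rewrite divr_gt0//=.
  by rewrite ltr_pdivrMr// mulr_natr.
move=> s0; have x2E : x = (x / 2) *+ 2 by rewrite -mulr_natr divfK.
rewrite x2E cos_mulr2n cos2sin2; apply/eqP.
have : 0 < sin (x / 2) ^+ 2 by rewrite exprn_gt0.
lra.
Qed.

Lemma circle_exp_injective_period T : 0 < T -> injective_period (circle_exp T) T.
Proof.
move=> T0; have Tn0 : T != 0 by rewrite gt_eqF.
split => // [t|s t /andP[st tT] [cE sE]].
  rewrite /circle_exp.
  have -> : 2 * pi * (t + T) / T = 2 * pi * t / T + pi *+ 2 by field.
  by rewrite cosD2pi sinD2pi.
pose x := 2 * pi * t / T - 2 * pi * s / T.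
have xE : x = pi *+ 2 * ((t - s) / T) by rewrite /x; field.
have pi2 : 0 < pi *+ 2 :> R by rewrite pmulrn_lgt0 ?pi_gt0.
have x0 : x = 0.
  apply: cos_eq1; last by rewrite /x cosB cE sE -!expr2 cos2Dsin2.
  have tsT : 0 <= (t - s) / T by rewrite divr_ge0 ?subr_ge0// ltW.
  rewrite xE mulr_ge0 ?(ltW pi2)//=.
  by rewrite gtr_pMr// ltr_pdivrMr// mul1r; lra.
move/eqP: x0; rewrite xE !mulf_eq0 gt_eqF//= invr_eq0 (negbTE Tn0) orbF subr_eq0.
by move/eqP.
Qed.

Lemma circle_exp_range T : 0 < T -> range (circle_exp T) = @circle R.
Proof.
move=> T0; have Tn0 : T != 0 by rewrite gt_eqF.
apply/seteqP; split => [_ [t _ <-]|[a b]]; first by rewrite /circle/= cos2Dsin2.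
rewrite /circle/= => ab.
have a1 : -1 <= a <= 1 by have := sqr_ge0 b; nra.
suff [x [<- <-]] : exists x : R, cos x = a /\ sin x = b.
  exists (x * T / (2 * pi)) => //; rewrite /circle_exp.
  have cancel (c : R) : c != 0 -> c * (x * T / c) / T = x.
    by move=> c0; field; rewrite c0 Tn0.
  by rewrite cancel// mulf_neq0// gt_eqF ?pi_gt0.
have cE : cos (acos a) = a by rewrite acosK// in_itv.
have sE : sin (acos a) = `|b|.
  by rewrite sin_acos// -sqrtr_sqr; congr Num.sqrt; lra.
have [b0|b0] := leP 0 b.
  by exists (acos a); rewrite cE sE ger0_norm.
by exists (- acos a); rewrite cosN sinN cE sE ltr0_norm// opprK.
Qed.

Lemma circle_exp_rotation T t tau : T != 0 ->
  circle_exp T (t + tau) = rotation (tau / T) (circle_exp T t).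
Proof.
move=> Tn0; rewrite /circle_exp /rotation/=.
have -> : 2 * pi * (t + tau) / T = 2 * pi * (tau / T) + 2 * pi * t / T by field.
by rewrite cosD sinD; congr pair; ring.
Qed.

End Periodic.

(** * The circle is not a continuous bijective image of the line *)

Section LineAndCircle.
Variable R : realType.

(** Invariance of domain in dimension one: on a segment around a point [v] is
    strictly monotone, and it takes all the intermediate values. *)
Lemma injective_image_open (v : R -> R) (A : set R) :
  open A -> {in A, continuous v} -> {in A &, injective v} -> open (v @` A).
Proof.
move=> oA vC vI; rewrite openE => _ [x Ax <-]; rewrite /interior.
have /nbhs_ballP[d /= d0 dA] : nbhs x A by exact: open_nbhs_nbhs.
pose e := d / 2.
have e0 : 0 < e by rewrite divr_gt0.
have ed : e < d by rewrite /e; lra.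
have eA y : y \in `[x - e, x + e] -> y \in A.
  rewrite in_itv/= -ler_distlC => xy; apply/mem_set/dA.
  by rewrite -ball_normE/= (le_lt_trans xy).
have vCe : {within `[x - e, x + e], continuous v}.
  by apply: continuous_in_subspaceT => y /set_mem/eA; exact: vC.
have vIe : {in `[x - e, x + e] &, injective v}.
  by move=> y z /eA yA /eA zA; exact: vI.
have xe : x \in `](x - e), (x + e)[ by rewrite in_itv/=; lra.
have := mono_mem_image_itvoo (itv_continuous_inj_mono vCe vIe) xe.
move=> /near_in_itvoo; apply: filterS => y yI.
have xeLxe : x - e <= x + e by lra.
have [z ze <-] := segment_continuous_surjective xeLxe vCe (subset_itv_oo_cc yI).
by exists z => //; exact/set_mem/eA.
Qed.

(** After the rotation [z |-> (u z, w z)] bringing the pole [(a, b)] to [(1, 0)],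
    the projection is [w / (1 - u)], with inverse
    [y |-> ((y^2 - 1) / (y^2 + 1), 2 y / (y^2 + 1))]. *)
Lemma stereographic_projection (a b : R) : circle (a, b) ->
  exists v : R * R -> R,
    [/\ forall z, circle z -> z <> (a, b) -> {for z, continuous v},
        forall z w, circle z -> circle w -> z <> (a, b) -> w <> (a, b) ->
          v z = v w -> z = w &
        forall y, exists z, [/\ circle z, z <> (a, b) & v z = y]].
Proof.
rewrite /circle/= => ab.
pose u (z : R * R) := a * z.1 + b * z.2.
pose w (z : R * R) := a * z.2 - b * z.1.
(* On the circle, [|z - (a, b)|^2 = 2 (1 - u z)]. *)
have u1 z : circle z -> z <> (a, b) -> 1 - u z != 0.
  case: z => c d; rewrite /circle/= /u/= => cd; apply: contra_notN => /eqP u0.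
  have : (c - a) ^+ 2 + (d - b) ^+ 2 = 0 by nra.
  move=> /eqP; rewrite paddr_eq0 ?sqr_ge0// !sqrf_eq0 !subr_eq0.
  by move=> /andP[/eqP -> /eqP ->].
have uw z : circle z -> u z ^+ 2 + w z ^+ 2 = 1.
  case: z => c d; rewrite /circle/= /u /w/= => cd.
  have -> : (a * c + b * d) ^+ 2 + (a * d - b * c) ^+ 2 =
            (a ^+ 2 + b ^+ 2) * (c ^+ 2 + d ^+ 2) by ring.
  by rewrite ab cd mulr1.
have zE z : z = (a * u z - b * w z, b * u z + a * w z).
  case: z => c d; rewrite /u /w/=; congr pair.
    have -> : a * (a * c + b * d) - b * (a * d - b * c) = (a ^+ 2 + b ^+ 2) * c by ring.
    by rewrite ab mul1r.
  have -> : b * (a * c + b * d) + a * (a * d - b * c) = (a ^+ 2 + b ^+ 2) * d by ring.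
  by rewrite ab mul1r.
exists (fun z => w z / (1 - u z)); split.
- move=> z zc zab.
  have uC : {for z, continuous u}.
    apply: cvgD; apply: cvgM; (exact: cvg_cst || exact: cvg_fst || exact: cvg_snd).
  have wC : {for z, continuous w}.
    apply: cvgB; apply: cvgM; (exact: cvg_cst || exact: cvg_fst || exact: cvg_snd).
  apply: cvgM => //; apply: cvgV; first exact: u1.
  by apply: cvgB => //; exact: cvg_cst.
- move=> z z' zc z'c zab z'ab eqv.
  (* [1 - u^2 = w^2] gives [y^2 = (1 + u) / (1 - u)] for [y = w / (1 - u)]. *)
  have key x : circle x -> x <> (a, b) ->
      u x = ((w x / (1 - u x)) ^+ 2 - 1) / ((w x / (1 - u x)) ^+ 2 + 1).
    move=> xc xab; have ux := u1 x xc xab.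
    have -> : (w x / (1 - u x)) ^+ 2 = (1 + u x) / (1 - u x).
      have -> : (w x / (1 - u x)) ^+ 2 = w x ^+ 2 / (1 - u x) ^+ 2 by rewrite expr_div_n.
      have -> : w x ^+ 2 = (1 - u x) * (1 + u x) by have := uw x xc; lra.
      by field.
    by field; rewrite ux/=; have -> : 1 + u x + (1 - u x) = 2 by ring.
  have equ : u z = u z' by rewrite (key z)// (key z')// eqv.
  have eqw : w z = w z'.
    by move: eqv; rewrite equ => /mulIf; apply; rewrite invr_eq0 u1.
  by rewrite (zE z) (zE z') equ eqw.
- move=> y; have y1 : y ^+ 2 + 1 != 0 by rewrite gt_eqF// ltr_wpDl// sqr_ge0.
  pose c := (y ^+ 2 - 1) / (y ^+ 2 + 1); pose d := 2 * y / (y ^+ 2 + 1).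
  have cd : c ^+ 2 + d ^+ 2 = 1 by rewrite /c /d; field.
  pose z := (a * c - b * d, b * c + a * d).
  have uz : u z = c.
    rewrite /u/=.
    have -> : a * (a * c - b * d) + b * (b * c + a * d) = (a ^+ 2 + b ^+ 2) * c by ring.
    by rewrite ab mul1r.
  have wz : w z = d.
    rewrite /w/=.
    have -> : a * (b * c + a * d) - b * (a * c - b * d) = (a ^+ 2 + b ^+ 2) * d by ring.
    by rewrite ab mul1r.
  have c1 : 1 - c = 2 / (y ^+ 2 + 1) by rewrite /c; field.
  exists z; split.
  + rewrite /z/=.
    have -> : (a * c - b * d) ^+ 2 + (b * c + a * d) ^+ 2 =
              (a ^+ 2 + b ^+ 2) * (c ^+ 2 + d ^+ 2) by ring.
    by rewrite ab cd mulr1.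
  + move=> zab; have : 1 - u z != 0 by rewrite uz c1 mulf_neq0// invr_eq0.
    by rewrite zab /u/= -!expr2 ab subrr eqxx.
  + by rewrite uz wz c1 /d; field.
Qed.

(** Projecting from the pole [G 0] would give a continuous bijection from the
    line without [0] onto the line.  By invariance of domain the images of the
    two half-lines are open, and they would disconnect the line. *)
Lemma no_continuous_bijection_line_circle (G : R -> R * R) :
  continuous G -> ~ set_bij setT (@circle R) G.
Proof.
move=> GC [Gfun Ginj Gsurj].
have GI s t : G s = G t -> s = t by apply: Ginj; rewrite inE.
have Gc t : circle (G t) by exact: Gfun.
case E : (G 0) => [a b]; have abc : circle (a, b) by rewrite -E.
have [v [vC vI vS]] := stereographic_projection abc.
have Gab t : t != 0 -> G t <> (a, b).
  by move=> t0 Gt; move/eqP: t0; apply; apply: GI; rewrite E.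
pose f t := v (G t).
have fC t : t != 0 -> {for t, continuous f}.
  by move=> t0; apply: continuous_comp; [exact: GC|apply: vC => //; exact: Gab].
have fI s t : s != 0 -> t != 0 -> f s = f t -> s = t.
  by move=> s0 t0 fst; apply/GI/vI => //; exact: Gab.
have pos0 (t : R) : `]0, +oo[%classic t -> t != 0.
  by rewrite /= in_itv/= andbT => /gt_eqF ->.
have neg0 (t : R) : `]-oo, 0[%classic t -> t != 0 by rewrite /= in_itv/= => /lt_eqF ->.
have oP : open (f @` `]0, +oo[).
  apply: injective_image_open => //
    [t /set_mem/pos0|s t /set_mem/pos0 s0 /set_mem/pos0 t0].
    exact: fC.
  exact: fI.
have oN : open (f @` `]-oo, 0[).
  apply: injective_image_open => //
    [t /set_mem/neg0|s t /set_mem/neg0 s0 /set_mem/neg0 t0].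
    exact: fC.
  exact: fI.
have PNT : f @` `]-oo, 0[ = ~` (f @` `]0, +oo[).
  apply/seteqP; split => [_ [t tN <-] [s sP]|y nP].
    move=> /fI -/(_ (pos0 _ sP) (neg0 _ tN)) st.
    by move: sP tN; rewrite /= !in_itv/= st; lra.
  have [z [zc zab vz]] := vS y; have [t _ Gt] := Gsurj z zc.
  exists t; last by rewrite /f Gt.
  rewrite /= in_itv/= ltNge le_eqVlt; apply/negP => /orP[/eqP t0|t0].
    by apply: zab; rewrite -Gt -t0.
  by apply: nP; exists t; [rewrite /= in_itv/= andbT|rewrite /f Gt].
have cT : connected [set: R] by exact/connected_intervalP.
have fN1 : (f @` `]-oo, 0[) (f (- 1)) by exists (- 1) => //=; rewrite in_itv/=; lra.
have : f @` `]0, +oo[ = setT.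
  apply: cT.
  - by exists (f 1); exists 1 => //=; rewrite in_itv/=; lra.
  - by exists (f @` `]0, +oo[) => //; rewrite setTI.
  - exists (f @` `]0, +oo[); last by rewrite setTI.
    by rewrite -openC -PNT.
by move=> PT; move: fN1; rewrite PNT PT; apply.
Qed.

End LineAndCircle.

(** * The parametrization of an orbit by time *)

Lemma C1_on_continuous (R : realType) (V W : normedModType R) (A : set V)
    (f : V -> W) : C1_on A f -> {within A, continuous f}.
Proof.
move=> fC; apply/subspace_continuousP => x Ax.
have [B [g [Bx [oB gD _] fg]]] := fC x Ax.
have gx : g @ within A (nbhs x) --> f x.
  rewrite (fg x)//; apply: cvg_within_filter.
  exact/differentiable_continuous/gD.
apply: cvg_trans gx; apply: near_eq_cvg.
have : \forall y \near x, B y by exact: open_nbhs_nbhs.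
by apply: filterS => y By Ay; exact/esym/fg.
Qed.

Lemma continuous_comp_within (S T1 T2 : topologicalType) (A : set T1)
    (phi : S -> T1) (f : T1 -> T2) :
  (forall s, A (phi s)) -> continuous phi -> {within A, continuous f} ->
  continuous (f \o phi).
Proof.
move=> Aphi phiC /subspace_continuousP fC s N fsN.
have : nbhs s (phi @^-1` [set y | A y -> N (f y)]).
  exact/phiC/(fC _ (Aphi s)).
by apply: filterS => t; apply; exact: Aphi.
Qed.

Section Orbit.
Variables (R : realType) (n : nat) (U : set 'rV[R]_n).
Variables (X : 'rV[R]_n -> 'rV[R]_n) (p : 'rV[R]_n).
Variables (I : set R) (phi : R -> 'rV[R]_n).
Hypotheses (X_C1 : C1_on U X) (phi_max : is_maximal_solution U X p I phi).

Lemma solution_continuous t : I t -> {for t, continuous phi}.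
Proof.
move=> It; have [_ _ [_ _ _ phiD] _] := phi_max.
by apply/differentiable_continuous/derivable1_diffP; case: (phiD t It).
Qed.

(** Two times with the same value differ by a period, which cannot be shorter
    than [T]. *)
Lemma minimal_period_injective T :
  is_minimal_period phi T -> I = setT -> injective_period phi T.
Proof.
move=> [[T0 phiT] Tmin] IT; split => // s t /andP[st tT] eqst.
apply/eqP; rewrite eq_le st leNgt; apply/negP => lt_st.
have [_ /Tmin] : I = setT /\ is_period phi (t - s).
  by apply: noninjective_solution_periodic phi_max _ _ lt_st eqst; rewrite // IT.
lra.
Qed.

(** Otherwise [phi] is defined on the whole line and periodic: if it is
    constant, [g] is constant too; if not, its image is homeomorphic to the
    circle, which [g] would parametrize by the line. *)
Lemma line_orbit_injective (g : R -> 'rV[R]_n) :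
  continuous g -> set_bij setT (orbit_of I phi) g ->
  forall s t, I s -> I t -> phi s = phi t -> s = t.
Proof.
move=> gC [gfun ginj gsurj] s t.
wlog st : s t / s < t.
  move=> wl Is It eqst; have [st|ts|//] := ltgtP s t; first exact: wl.
  by apply/esym; apply: wl.
move=> Is It eqst; exfalso.
have [IT per] := noninjective_solution_periodic X_C1 phi_max Is It st eqst.
have phiC : continuous phi by move=> u; apply: solution_continuous; rewrite IT.
have orbE : orbit_of I phi = range phi by rewrite /orbit_of IT.
rewrite orbE in gfun ginj gsurj.
have [ncst|cst] := pselect (exists a b, phi a <> phi b); last first.
  have gcst x y : g x = g y.
    have [a _ <-] := gfun x Logic.I; have [b _ <-] := gfun y Logic.I.
    by apply: contrapT => neq; apply: cst; exists a, b.
  have /eqP := ginj 0 1 (mem_set Logic.I) (mem_set Logic.I) (gcst 0 1).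
  by rewrite eq_sym oner_eq0.
have [|T Tmin] := minimal_period_exists phiC ncst; first by exists (t - s).
have phiT := minimal_period_injective Tmin IT.
have T0 : 0 < T by case: phiT.
have [h [k [[hfun kfun hK kK] hC _ _]]] := injective_period_homeomorphism
  (@norm_hausdorff _ _) (@norm_hausdorff _ _) phiC (circle_exp_continuous (T := T)) phiT
  (circle_exp_injective_period T0).
rewrite (circle_exp_range T0) in hfun kfun kK.
have grange x : range phi (g x) by exact: gfun.
apply: (@no_continuous_bijection_line_circle R (h \o g)).
  exact: continuous_comp_within grange gC hC.
split.
- by move=> x _ /=; exact: hfun.
- move=> x y xT yT /= /(congr1 k); rewrite !hK// => gxy; exact: ginj.
- move=> z zc; have [x _ gx] := gsurj _ (kfun _ zc).
  by exists x => //=; rewrite gx kK.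
Qed.

(** The conjugating map is the inverse of [phi].  Its continuity on the orbit,
    with the subspace topology, comes from [f]: the map [f \o phi] is a
    continuous bijection of the line, so it has a continuous inverse [m], and
    the inverse of [phi] is [m \o f]. *)
Lemma line_orbit_conjugated_translation (F : 'rV[R]_n -> 'rV[R]_n)
    (f : 'rV[R]_n -> R) (g : R -> 'rV[R]_n) (tau : R) :
  inverse_on (orbit_of I phi) setT f g ->
  {within orbit_of I phi, continuous f} -> continuous g -> I = setT ->
  (forall t, F (phi t) = phi (t + tau)) ->
  conjugated (orbit_of I phi) F [set: R] (translation tau).
Proof.
move=> [ffun gfun fK gK] fC gC IT Fphi.
have phiC : continuous phi by move=> u; apply: solution_continuous; rewrite IT.
have orbP t : orbit_of I phi (phi t) by exists t => //; rewrite IT.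
have gbij : set_bij setT (orbit_of I phi) g.
  split=> //; first by move=> x y _ _ /(congr1 f); rewrite !gK.
  by move=> q qorb; exists (f q) => //; exact: fK.
have phiI s t : phi s = phi t -> s = t.
  by apply: (line_orbit_injective gC gbij); rewrite IT.
pose w := f \o phi.
pose m (y : R) : R := xget 0 [set t | w t = y].
have wI s t : w s = w t -> s = t.
  by move=> /(congr1 g); rewrite /w/= !fK//; exact: phiI.
have wK t : m (w t) = t.
  by rewrite /m; case: xgetP => [s _ /wI//|/(_ t)/(_ erefl)].
have mK y : w (m y) = y.
  have [t _ tE] : orbit_of I phi (g y) by exact: gfun.
  by have : w t = y; [rewrite /w/= tE gK|move=> <-; rewrite wK].
have wC : continuous w by exact: continuous_comp_within orbP phiC fC.
have mC : continuous m.
  move=> y; rewrite -(mK y).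
  have wKn : {near m y, cancel w m} by near=> t; exact: wK.
  have wCn : {near m y, continuous w} by near=> t; exact: wC.
  exact: nbhs_singleton (near_can_continuous wKn wCn).
exists (m \o f), phi; split.
- split => //.
  + by move=> _ [t _ <-] /=; rewrite -[f _]/(w t) wK.
  + by move=> t _ /=; exact: wK.
- by move=> x; exact: (continuous_comp (fC x) (mC (f x))).
- exact: continuous_subspaceT.
- by move=> _ [t _ <-]; rewrite Fphi /= -[f (phi t)]/(w t) -[f _]/(w (t + tau)) !wK.
Unshelve. all: by end_near. Qed.

Lemma solution_C1 : open U -> I = setT -> C1_open setT phi.
Proof.
move=> oU IT; have [_ _ [_ _ phiU phiD] _] := phi_max.
have phiC t : {for t, continuous phi} by apply: solution_continuous; rewrite IT.
have phidiff t : differentiable phi t.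
  apply/derivable1_diffP.
  by have [] : is_derive t 1 phi (X (phi t)) by apply: phiD; rewrite IT.
split => //; first exact: openT.
move=> v t _.
have -> : (fun y => 'd phi y v) = (fun y => v *: X (phi y)).
  apply/funext => y; rewrite diff1E// derive1E.
  by have [_ ->] : is_derive y 1 phi (X (phi y)) by apply: phiD; rewrite IT.
apply: cvgZ; first exact: cvg_cst.
apply: continuous_comp; first exact: phiC.
apply/differentiable_continuous/(C1_on_differentiable oU X_C1)/phiU.
by rewrite IT.
Qed.

Lemma solution_immersed_line : open U -> I = setT ->
  (forall s t, phi s = phi t -> s = t) -> immersed_line (orbit_of I phi) phi.
Proof.
move=> oU IT phiI; split; last 2 first.
- exact: solution_C1.
- move=> s; have [_ _ [_ _ _ phiD] _] := phi_max.
  have [_ ->] : is_derive s 1 phi (X (phi s)) by apply: phiD; rewrite IT.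
  move=> Xs; have : phi (s + 1) = phi s.
    by apply: critical_orbit_constant X_C1 phi_max _ Xs _ _; rewrite IT.
  by move=> /phiI; lra.
- rewrite /orbit_of IT; split.
  + by move=> t _; exists t.
  + by move=> s t _ _; exact: phiI.
  + by move=> _ [t _ <-]; exists t.
Qed.

End Orbit.

Theorem theorem1 (R : realType) (n : nat) (U : set 'rV[R]_n)
    (F X : 'rV[R]_n -> 'rV[R]_n) (p : 'rV[R]_n)
    (I : set R) (phi : R -> 'rV[R]_n)
    (U_open : open U) (U_connected : connected U)
    (F_diffeo : diffeomorphism U U F)
    (X_C1 : C1_on U X)
    (F_symmetry : forall q, U q -> X (F q) = 'd F q (X q))
    (Up : U p)
    (phi_sol : is_maximal_solution U X p I phi)
    (gamma_invariant : F @` orbit_of I phi `<=` orbit_of I phi) :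
  [/\ (* (a) *)
      is_critical_point X p -> F p = p,
      (* (b) *)
      is_periodic_orbit I phi ->
        exists T : R,
          [/\ is_minimal_period phi T,
              exists tau : R, phi tau = F p
            & forall tau : R, phi tau = F p ->
                conjugated (orbit_of I phi) F
                  (@circle R) (rotation (tau / T))]
    & (* (c) *)
      (diffeomorphic (orbit_of I phi) [set: R] ->
        exists c : R,
          conjugated (orbit_of I phi) F [set: R] (translation c))
      /\ ((exists g : R -> 'rV[R]_n, immersed_line (orbit_of I phi) g) ->
        exists c : R, exists k : R -> 'rV[R]_n,
          immersed_line (orbit_of I phi) k
          /\ forall s : R, F (k s) = k (translation c s))].

Proof.
have [I0 phi0 phiS _] := phi_sol; have [_ iI phiU _] := phiS.
have [tau Itau tauE] : orbit_of I phi (F p).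
  by apply: gamma_invariant; exists p => //; exists 0.
have shift := symmetry_shifts_time U_open X_C1 F_diffeo F_symmetry phi_sol.
split.
- move=> Xp; rewrite -tauE.
  have X0 : X (phi 0) = 0 by rewrite phi0.
  by rewrite (critical_orbit_constant X_C1 phi_sol I0 X0 Itau).
- move=> [IT ncst perT].
  have phiC : continuous phi.
    by move=> u; apply: (solution_continuous phi_sol); rewrite IT.
  have [T Tmin] := minimal_period_exists phiC ncst perT.
  have phiT := minimal_period_injective X_C1 phi_sol Tmin IT.
  have T0 : 0 < T by case: phiT.
  exists T; split => //; first by exists tau.
  move=> s sE.
  have [h [k [hk hC kC hE]]] := injective_period_homeomorphism
    (@norm_hausdorff _ _) (@norm_hausdorff _ _) phiC (circle_exp_continuous (T := T)) phiT
    (circle_exp_injective_period T0).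
  rewrite (circle_exp_range T0) in hk kC.
  rewrite /orbit_of IT; exists h, k; split => // _ [t _ <-].
  have [||_ _ ->] := shift s _ sE t; rewrite ?IT//.
  by rewrite !hE circle_exp_rotation// gt_eqF.
have IT : tau != 0 -> I = setT.
  move=> tau0; apply: (is_interval_shift_invariant iI tau0 I0) => t It.
    by have [] := shift tau Itau tauE t It.
  by have [] := shift tau Itau tauE t It.
have Fid : tau = 0 -> forall q, orbit_of I phi q -> F q = q.
  move=> t0 _ [t It <-]; have [_ _ ->] := shift tau Itau tauE t It.
  by rewrite t0 addr0.
split.
- move=> [f [g [fg fC gC]]].
  have fC' := C1_on_continuous fC.
  have gC' : continuous g by apply/continuous_subspace_setT/C1_on_continuous.
  have [t0|t0] := eqVneq tau 0.
    exists 0, f, g; split => //; first exact: continuous_subspaceT.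
    by move=> x xorb; rewrite Fid// /translation addr0.
  exists tau; apply: (line_orbit_conjugated_translation X_C1 phi_sol fg) => //.
    exact: IT.
  by move=> t; have [|_ _ ->//] := shift tau Itau tauE t; rewrite IT.
- move=> [g gimm]; have [gbij [_ gD _] _] := gimm.
  have [t0|t0] := eqVneq tau 0.
    exists 0, g; split => // s; rewrite /translation addr0 Fid//.
    by have [gfun _ _] := gbij; exact: gfun.
  have gC : continuous g by move=> x; exact/differentiable_continuous/gD.
  exists tau, phi; split.
    apply: (solution_immersed_line X_C1 phi_sol) => //; first exact: IT.
    move=> s t; apply: (line_orbit_injective X_C1 phi_sol gC gbij); by rewrite IT.
  by move=> t; have [|_ _ ->//] := shift tau Itau tauE t; rewrite IT.
Qed.
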